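(* Let $G$ be an infinite group. Then every element of $G$ has odd order if and only if for every partition $G=A\cup B$ either $G=\Delta(A)$ or $G=\Delta(B)$.
   Context: For $A\subseteq G$, $\Delta(A)=\{g\in G:|gA\cap A|=\infty\}$. *)

(* Defs.v *)
From mathcomp Require Import all_boot monoid.
From mathcomp Require Import boolp classical_sets functions cardinality.

Set Implicit Arguments.
Unset Strict Implicit.
Unset Printing Implicit Defensive.

Local Open Scope group_scope.
Local Open Scope classical_set_scope.

(* [fingroup]'s #[g] only exists for finite groups; here the order is a relation,
   and an element of infinite order is related to no [n]. *)
Definition is_order (G : groupType) (g : G) (n : nat) : Prop :=
  [/\ (0 < n)%N, g ^+ n = 1
    & forall m : nat, (0 < m < n)%N -> g ^+ m <> 1].

Definition odd_order (G : groupType) (g : G) : Prop :=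
  exists2 n : nat, is_order g n & odd n.

Definition ltranslate (G : groupType) (g : G) (A : set G) : set G :=
  [set g * a | a in A].

Definition Delta (G : groupType) (A : set G) : set G :=
  [set g : G | infinite_set (ltranslate g A `&` A)].

(* Empty cells are allowed. *)
Definition partition2 (T : Type) (A B : set T) : Prop :=
  A `|` B = [set: T] /\ A `&` B = set0.

(* Main.v *)
Require Import Defs.
From mathcomp Require Import all_boot monoid.
From mathcomp Require Import boolp classical_sets functions cardinality.

Local Open Scope classical_set_scope.

(** If some [g] does not have odd order, the orbits of left multiplication by
    [g] can be coloured alternately, so that [g] exchanges the two cells.
    Conversely, if [g] is not in [Delta A] and [h] is not in [Delta B], then up
    to finite sets [g] maps [A] into [B] and [h] maps [B] into [A].  As [h * g]
    has finite order, its inverse also maps [A] into itself up to a finite set,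
    and this forces [h] to map [A] into [B].  An odd power of [h] then almost
    exchanges [A] and [B]; since some odd power of [h] is [1], both are finite. *)

Section Group.
Set Implicit Arguments.
Unset Strict Implicit.
Unset Printing Implicit Defensive.
Variable G : groupType.
Implicit Types (g h x : G) (A B C : set G).
Local Open Scope group_scope.

(** The least positive exponent sending [g] to 1 divides every other such exponent, and a divisor of
    an odd number is odd. *)
Lemma odd_orderP g : odd_order g <-> exists2 n, odd n & g ^+ n = 1.
Proof.
split=> [[n [_ gn1 _] odd_n]|[k odd_k gk1]]; first by exists n.
have ex_n : exists n, (0 < n)%N && (g ^+ n == 1).
  by exists k; rewrite gk1 eqxx andbT; case: k odd_k {gk1}.
case: (ex_minnP ex_n) => d /andP[d_gt0 /eqP gd1] d_min.
exists d.
  split=> // m /andP[m_gt0 m_lt_d] gm1.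
  by have := d_min m; rewrite m_gt0 gm1 eqxx leqNgt m_lt_d => /(_ isT).
apply: dvdn_odd odd_k; rewrite /dvdn -leqn0 leqNgt; apply/negP => r_gt0.
have gr1 : g ^+ (k %% d) = 1.
  by move: gk1; rewrite {1}(divn_eq k d) expgnDr mulnC expgnA gd1 expg1n mul1g.
by have := d_min (k %% d); rewrite r_gt0 gr1 eqxx leqNgt ltn_mod d_gt0 => /(_ isT).
Qed.

Lemma odd_order_eq_expg g a b : odd (a + b) -> g ^+ a = g ^+ b -> odd_order g.
Proof.
wlog le_ab : a b / (a <= b)%N.
  by case/orP: (leq_total a b) => le H;
    [apply: H | rewrite addnC => o /esym; apply: H].
move=> odd_ab eq_ab; apply/odd_orderP; exists (b - a)%N.
  by rewrite oddB // addbC -oddD.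
by apply: (mulgI (g ^+ a)); rewrite -expgnDr subnKC // mulg1 eq_ab.
Qed.

(** The orbit of [x] under the cyclic group generated by [g]; powers on both sides replace negative
    exponents. *)
Definition same_orbit g x : set G := [set y | exists m n, g ^+ m * x = g ^+ n * y].

Definition orbit_repr g x : G := xget 1 (same_orbit g x).

Lemma orbit_reprP g x : same_orbit g x (orbit_repr g x).
Proof. by apply: (xgetPex 1); exists x, 0%N, 0%N. Qed.

(** [x] and [g * x] have equal orbits as sets, so the choice made by [xget] is the same. *)
Lemma orbit_reprM g x : orbit_repr g (g * x) = orbit_repr g x.
Proof.
congr (xget 1 _); apply/seteqP; split=> y [m [n e]].
  by exists m.+1, n; rewrite expgSr -mulgA.
by exists m, n.+1; rewrite mulgA -expgSr !expgS -!mulgA e.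
Qed.

(** One colour of the alternating colouring: [m + n] has the parity of [n - m], the exponent of [g]
    that takes the representative to [x]. *)
Definition even_class g : set G :=
  [set x | exists m n, ~~ odd (m + n) /\ g ^+ m * x = g ^+ n * orbit_repr g x].

Lemma even_classM g x : ~ odd_order g ->
  even_class g (g * x) <-> ~ even_class g x.
Proof.
move=> not_odd; split=> [[p [q [pq e']]] [m [n [mn e]]]|not_even].
  (* If [x] and [g * x] were both even, comparing their two paths to the common representative would
     equate powers of [g] whose exponents differ in parity. *)
  apply: not_odd; apply: (@odd_order_eq_expg g (p.+1 + n) (m + q)).
    by move: pq mn; rewrite !oddD /=; do 4!case: odd.
  apply: (mulIg (orbit_repr g x)).
  rewrite !expgnDr -!mulgA -e -orbit_reprM -e' (mulgA _ g x) -expgSr.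
  by rewrite !mulgA -!expgnDr addnC.
have [m [n e]] := orbit_reprP g x.
have [even_mn|odd_mn] := boolP (~~ odd (m + n)); first by case: not_even; exists m, n.
exists m, n.+1; rewrite addnS /= odd_mn; split=> //.
by rewrite orbit_reprM mulgA -expgSr !expgS -!mulgA e.
Qed.

Definition almost_maps g A B := finite_set [set x | A x /\ ~ B (g * x)].

Lemma finite_preimage_mulg g A : finite_set A -> finite_set ((fun x => g * x) @^-1` A).
Proof. by apply: finite_preimage => x y _ _; apply: mulgI. Qed.

(** Left multiplication by [g] is a bijection from the points of [A] that stay in [A] onto the
    intersection of [A] with its translate. *)
Lemma not_DeltaP g A : ~ Delta A g <-> almost_maps g A (~` A).
Proof.
rewrite /Delta /= not_notE /almost_maps; split=> [|fin].
  move=> /(finite_preimage_mulg g); apply: sub_finite_set => x [Ax /contrapT Agx].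
  by split=> //; exists x.
apply: sub_finite_set (finite_image (fun x => g * x) fin) => _ [[x Ax <-] Agx].
by exists x => //; split=> //; apply.
Qed.

Lemma almost_mapsM g h A B C :
  almost_maps h A B -> almost_maps g B C -> almost_maps (g * h) A C.
Proof.
move=> hAB /(finite_preimage_mulg h) gBC.
have : finite_set ([set x | A x /\ ~ B (h * x)] `|`
    (fun x => h * x) @^-1` [set x | B x /\ ~ C (g * x)]) by rewrite finite_setU.
apply: sub_finite_set => x [Ax]; rewrite -mulgA => nC.
by have [Bx|nBx] := pselect (B (h * x)); [right|left].
Qed.

Lemma almost_mapsX g A n : almost_maps g A A -> almost_maps (g ^+ n) A A.
Proof.
move=> gA; elim: n => [|n IHn].
  apply: (sub_finite_set _ (@finite_set0 G)) => x [Ax].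
  by rewrite expg0 mul1g.
by rewrite expgS; apply: almost_mapsM gA.
Qed.

Lemma almost_mapsV g A B : almost_maps g A B -> almost_maps g^-1 (~` B) (~` A).
Proof.
move=> /(finite_preimage_mulg g^-1); apply: sub_finite_set => x [nBx /contrapT Ax].
by split=> //; rewrite mulVKg.
Qed.

Lemma odd_order_almost_swap h A B : odd_order h ->
  almost_maps h A B -> almost_maps h B A -> almost_maps 1 A B.
Proof.
move=> [n [_ hn1 _] odd_n] hAB hBA; rewrite -hn1 -(odd_double_half n) odd_n.
(* The odd power is [h] after a power of [h ^+ 2], and [h ^+ 2] almost maps [A] into itself. *)
rewrite add1n expgS -mul2n expgnA.
by apply: almost_mapsM (hAB); apply: almost_mapsX; apply: almost_mapsM hAB hBA.
Qed.

Lemma almost_maps1C A : almost_maps 1 A (~` A) -> finite_set A.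
Proof. by apply: sub_finite_set => x Ax; split=> //; rewrite mul1g => /(_ Ax). Qed.

Lemma odd_order_finite g h A : (forall x, odd_order x) ->
  almost_maps g A (~` A) -> almost_maps h (~` A) A -> finite_set [set: G].
Proof.
move=> odd_G gA hB.
have hgV : almost_maps (h * g)^-1 A A.
  (* When the order is [n.+1], the inverse is the [n]-th power. *)
  have [[//|n] [_ u1 _] _] := odd_G (h * g).
  have -> : (h * g)^-1 = (h * g) ^+ n.
    by apply: (mulgI (h * g)); rewrite mulgV -expgS u1.
  by apply: almost_mapsX; apply: almost_mapsM gA hB.
have hA : almost_maps h A (~` A).
  (* Since [g * (h * g)^-1] equals [h^-1], the latter almost maps [A] into its complement; inverting
     swaps and complements the two sets, which gives the same for [h]. *)
  have := almost_mapsV (almost_mapsM hgV gA).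
  by rewrite invgM invgK mulgK setCK.
rewrite -(setUv A) finite_setU; split; apply: almost_maps1C.
  exact: odd_order_almost_swap (odd_G h) hA hB.
by rewrite setCK; apply: odd_order_almost_swap (odd_G h) hB hA.
Qed.

End Group.

Theorem theorem4p4 (G : groupType) (hG : infinite_set [set: G]) :
  (forall g : G, odd_order g) <->
  (forall A B : set G, partition2 A B ->
     [set: G] = Delta A \/ [set: G] = Delta B).
Proof.
have fullP (D : set G) : [set: G] <> D -> exists g, ~ D g.
  by move=> nD; apply/existsNP => allD; apply: nD; apply/esym/seteqP; split.
split=> [odd_G A B [AUB AIB]|part g].
  have -> : B = ~` A.
    apply/seteqP; split=> x; first by move=> Bx Ax; rewrite -[False]/(set0 x) -AIB.
    by have: [set: G] x by []; rewrite -AUB => -[|].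
  apply: contrapT => /not_orP[/fullP[g /not_DeltaP gA] /fullP[h /not_DeltaP]].
  by rewrite setCK => hB; apply: hG; apply: odd_order_finite odd_G gA hB.
apply: contrapT => not_odd; pose E := even_class g.
have swapE x : E (g * x)%g <-> ~ E x := even_classM x not_odd.
have finE0 (S : set G) : (forall x, ~ S x) -> finite_set S.
  by move=> S0; apply: (sub_finite_set _ (@finite_set0 G)) => x /S0.
have partE : partition2 E (~` E) by split; [exact: setUv | exact: setICr].
(* By [swapE] the exceptional sets are empty for both cells, so [g] lies in neither [Delta]. *)
have [full|full] := part _ _ partE.
- suff: ~ Delta E g by rewrite -full; apply.
  by apply/not_DeltaP; apply: finE0 => x [Ex /contrapT /swapE].
- suff: ~ Delta (~` E) g by rewrite -full; apply.
  by apply/not_DeltaP; rewrite setCK; apply: finE0 => x [/swapE Egx].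
Qed.
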